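(* $$[\mathcal{H}_{v\mathcal{O}}^\infty,\|\cdot\|_v]=[\mathcal{S}^{-1}\circ\mathcal{H}_{v\mathcal{K}_w}^\infty,\|\cdot\|_{\mathcal{S}^{-1}\circ\mathcal{H}_{v\mathcal{K}_w}^\infty}].$$ That is, for every open subset $U$ of a complex Banach space, every weight $v$ on $U$, every complex Banach space $F$ and every $f\in\mathcal{H}_v^\infty(U,F)$: $f$ is Grothendieck weighted holomorphic if and only if $A\circ f\in\mathcal{H}_{v\mathcal{K}_w}^\infty(U,G)$ for every complex Banach space $G$ and every separable operator $A\in\mathcal{S}(F,G)$; and in this case $\|f\|_v=\|f\|_{\mathcal{S}^{-1}\circ\mathcal{H}_{v\mathcal{K}_w}^\infty}$.
   Context: All Banach spaces are complex. A weight $v$ on an open subset $U$ of a Banach space is a strictly positive continuous function on $U$. $\mathcal{H}_v^\infty(U,F)$ is the Banach space of holomorphic $f:U\to F$ with $\|f\|_v:=\sup_{x\in U}v(x)\|f(x)\|<\infty$. Write $(vf)(U)=\{v(x)f(x):x\in U\}$. A subset $K$ of a Banach space $F$ is Grothendieck if $T(K)$ is relatively weakly compact in $c_0$ for every $T\in\mathcal{L}(F,c_0)$. $\mathcal{H}_{v\mathcal{O}}^\infty(U,F)$ is the space of Grothendieck weighted holomorphic mappings, i.e. those $f\in\mathcal{H}_v^\infty(U,F)$ for which $(vf)(U)$ is a Grothendieck subset of $F$, with norm $\|\cdot\|_v$. $\mathcal{H}_{v\mathcal{K}_w}^\infty(U,F)$ is the space of weakly compact weighted holomorphic mappings, i.e.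 those $f\in\mathcal{H}_v^\infty(U,F)$ for which $(vf)(U)$ is relatively weakly compact in $F$, with norm $\|\cdot\|_v$. $\mathcal{S}$ is the ideal of separable bounded operators ($A\in\mathcal{L}(F,G)$ such that $A(B_F)$ is separable, $B_F$ the closed unit ball), with the operator norm. The left-hand quotient $\mathcal{S}^{-1}\circ\mathcal{H}_{v\mathcal{K}_w}^\infty(U,F)$ is the set of $f\in\mathcal{H}_v^\infty(U,F)$ such that $A\circ f\in\mathcal{H}_{v\mathcal{K}_w}^\infty(U,G)$ for every Banach space $G$ and every $A\in\mathcal{S}(F,G)$, with norm $\|f\|_{\mathcal{S}^{-1}\circ\mathcal{H}_{v\mathcal{K}_w}^\infty}:=\sup\{\|A\circ f\|_v:A\in\mathcal{S}(F,G),\ \|A\|\le1\}$, $G$ ranging over all Banach spaces. Equality of ideals means equality of sets and of norms. *)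

(* Defs.v *)
From HB Require Import structures.
From mathcomp Require Import all_boot all_order all_algebra.
From mathcomp Require Import all_classical all_reals all_analysis.
From mathcomp.real_closed Require Export complex.

Set Implicit Arguments.
Unset Strict Implicit.
Unset Printing Implicit Defensive.

Import Order.TTheory GRing.Theory Num.Theory.
Import numFieldNormedType.Exports.

Local Open Scope classical_set_scope.
Local Open Scope ring_scope.
Local Open Scope complex_scope.

(* Complex Banach spaces are completeNormedModType R[i] with R : realType.
   The library norm `|x| of such a space lies in R[i]; rnorm is the same norm
   as an element of R, so that suprema can be taken in R. *)
Definition rnorm (R : realType) (F : normedModType R[i]) (x : F) : R :=
  complex.Re `|x|.

Section rnorm_theory.
Context {R : realType} {F : normedModType R[i]}.
Implicit Types x y : F.

Lemma rnormE x : `|x| = (rnorm x)%:C.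
Proof. by rewrite /rnorm RRe_real// ger0_real. Qed.

Lemma rnorm_ge0 x : 0 <= rnorm x.
Proof. by rewrite -lecR -rnormE normr_ge0. Qed.

Lemma ler_rnormD x y : rnorm (x + y) <= rnorm x + rnorm y.
Proof. by rewrite -lecR rmorphD/= -!rnormE ler_normD. Qed.

Lemma rnormZ (l : R[i]) x : rnorm (l *: x) = complex.Re `|l| * rnorm x.
Proof.
rewrite {1}/rnorm normrZ rnormE -[`|l|](RRe_real (ger0_real (normr_ge0 l))).
by rewrite -rmorphM.
Qed.

End rnorm_theory.

Section complex_complete.
Context {R : realType}.

Lemma normc_i : `|'i%C : R[i]| = 1.
Proof. by rewrite normc_def/= expr0n/= expr1n add0r sqrtr1. Qed.

Lemma norm_real_complex (x : R) : `|x%:C| = `|x|%:C.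
Proof. by rewrite normc_def/= expr0n/= addr0 sqrtr_sqr. Qed.

Lemma normc_ge_Im (z : R[i]) : `|complex.Im z|%:C <= `|z|.
Proof.
rewrite -normrN -ReiNIm (le_trans (normc_ge_Re _))// normrM.
by rewrite normc_i mulr1.
Qed.

Lemma complex_complete (F : set_system R[i]^o) :
  ProperFilter F -> cauchy F -> cvg F.
Proof.
move=> FF /cauchyP Fc.
have part (h : R[i] -> R) :
    (forall x y, h (x - y) = h x - h y) -> (forall x, `|h x|%:C <= `|x|) ->
    cvg (h @ F).
  move=> hB hle; apply/cauchy_cvgP/cauchyP => e e0.
  have e0' : 0 < e%:C :> R[i] by rewrite ltcR.
  have [x Fx] := Fc _ e0'; exists (h x).
  suff : F (h @^-1` ball (h x) e) by [].
  apply: filterS Fx => y; rewrite /preimage/= -!ball_normE /= => xye.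
  by rewrite -ltcR -hB (le_lt_trans (hle _)).
have /cvg_ex[a Fa] :=
  part (@complex.Re R) (fun x y => raddfB (@complex.Re R) x y) (@normc_ge_Re R).
have /cvg_ex[b Fb] :=
  part (@complex.Im R) (fun x y => raddfB (@complex.Im R) x y) normc_ge_Im.
apply/cvg_ex; exists (a +i* b); apply/cvgrPdist_lt => e e0.
have eE : e = (complex.Re e)%:C by rewrite RRe_real// gtr0_real.
have e20 : 0 < complex.Re e / 2 by rewrite divr_gt0// -ltcR -eE.
move/cvgrPdist_lt : Fa => /(_ _ e20) Fa.
move/cvgrPdist_lt : Fb => /(_ _ e20) Fb.
near=> z.
rewrite [_ - _]complexE (le_lt_trans (ler_normD _ _))// normrM normc_i mul1r.
rewrite !norm_real_complex eE -rmorphD/= ltcR !raddfB/= [ltRHS]splitr ltrD//.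
  by near: z.
by near: z.
Unshelve. all: by end_near. Qed.

End complex_complete.

Lemma cvg0_linear (K : numFieldType) (V : normedModType K) (a : K)
    (u v : nat -> V) :
  u @ \oo --> (0 : V) -> v @ \oo --> (0 : V) -> (a *: u + v) @ \oo --> (0 : V).
Proof.
move=> u0 v0; have -> : 0 = a *: (0 : V) + 0 by rewrite scaler0 addr0.
by apply: cvgD => //; exact: cvgZl_tmp.
Qed.

Section c0.
Context {R : realType}.

Definition null_seq : {pred (nat -> R[i]^o)} :=
  [pred u : nat -> R[i]^o | `[< u @ \oo --> (0 : R[i]^o) >]].

Record c0 : Type := C0 { c0_seq : nat -> R[i]^o ; _ : c0_seq \in null_seq }.

HB.instance Definition _ := [isSub for c0_seq].
HB.instance Definition _ := [Choice of c0 by <:].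

Lemma null_seq_submod : submod_closed null_seq.
Proof.
split => [|a u v /asboolP u0 /asboolP v0]; apply/asboolP.
  exact: (@cvg_cst R[i]^o).
exact: (@cvg0_linear R[i] R[i]^o).
Qed.

HB.instance Definition _ := GRing.isSubmodClosed.Build R[i] (nat -> R[i]^o)
  null_seq null_seq_submod.
HB.instance Definition _ := [SubChoice_isSubLmodule of c0 by <:].

Lemma c0P (u : c0) : c0_seq u @ \oo --> (0 : R[i]^o).
Proof. by case: u => u /= /asboolP. Qed.

Definition c0_sup (u : c0) : R := sup (range (fun n => rnorm (c0_seq u n))).

Lemma c0_has_ubound (u : c0) :
  has_ubound (range (fun n => rnorm (c0_seq u n))).
Proof.
have /cvgrPdist_lt/(_ 1 ltr01)[N _ uN] := c0P u.
pose M := \sum_(i < N) rnorm (c0_seq u i).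
exists (1 + M) => _ [n _ <-].
have M0 : 0 <= M by apply: sumr_ge0 => i _; exact: rnorm_ge0.
have [nN|Nn] := ltnP n N.
  rewrite /M (bigD1 (Ordinal nN))//= addrCA lerDl addr_ge0//.
  by apply: sumr_ge0 => i _; exact: rnorm_ge0.
rewrite addrC -[leLHS]add0r lerD// -lecR -rnormE ltW//.
by have := uN n Nn; rewrite /= sub0r normrN.
Qed.

Lemma c0_sup_ge (u : c0) n : rnorm (c0_seq u n) <= c0_sup u.
Proof. by apply: ub_le_sup; [exact: c0_has_ubound|exists n]. Qed.

Lemma c0_sup_le (u : c0) (M : R) :
  (forall n, rnorm (c0_seq u n) <= M) -> c0_sup u <= M.
Proof.
move=> uM; apply: ge_sup; first by exists (rnorm (c0_seq u 0)), 0%N.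
by move=> _ [n _ <-].
Qed.

Lemma c0_sup_ge0 (u : c0) : 0 <= c0_sup u.
Proof. exact: le_trans (rnorm_ge0 _) (c0_sup_ge u 0). Qed.

Let c0_norm (u : c0) : R[i] := (c0_sup u)%:C.

Let c0_normD u v : c0_norm (u + v) <= c0_norm u + c0_norm v.
Proof.
rewrite -rmorphD lecR; apply: c0_sup_le => n.
by rewrite (le_trans (ler_rnormD _ _))// lerD// c0_sup_ge.
Qed.

Let c0_normZ (a : R[i]) u : c0_norm (a *: u) = `|a| * c0_norm u.
Proof.
rewrite /c0_norm -[`|a|](RRe_real (ger0_real (normr_ge0 a))) -rmorphM.
have : 0 <= complex.Re `|a|.
  by rewrite -lecR (RRe_real (ger0_real (normr_ge0 a))) normr_ge0.
set k := complex.Re `|a| => k0; congr (_%:C).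
apply/eqP; rewrite eq_le; apply/andP; split.
  by apply: c0_sup_le => n; rewrite rnormZ ler_wpM2l// c0_sup_ge.
have [->|k_neq0] := eqVneq k 0; first by rewrite mul0r c0_sup_ge0.
have kgt0 : 0 < k by rewrite lt0r k_neq0.
rewrite mulrC -ler_pdivlMr//; apply: c0_sup_le => n.
by rewrite ler_pdivlMr// mulrC -rnormZ; exact: (c0_sup_ge (a *: u)).
Qed.

Let c0_norm0_eq0 u : c0_norm u = 0 -> u = 0.
Proof.
move=> /(congr1 (@complex.Re R)) /= u0; apply: val_inj; apply/funext => n /=.
apply/normr0_eq0; rewrite rnormE; congr (_%:C).
by apply/eqP; rewrite eq_le rnorm_ge0 andbT -u0 c0_sup_ge.
Qed.

HB.instance Definition _ :=
  Lmodule_isNormed.Build R[i] c0 c0_normD c0_normZ c0_norm0_eq0.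

Lemma c0_normE (u : c0) : `|u| = (c0_sup u)%:C.
Proof. by []. Qed.

Lemma c0_coord_le (u : c0) n : `|c0_seq u n| <= `|u|.
Proof. by rewrite rnormE c0_normE lecR c0_sup_ge. Qed.

Lemma c0_complete (F : set_system c0) : ProperFilter F -> cauchy F -> cvg F.
Proof.
move=> FF /cauchyP Fc.
have /choice[l Fl] : forall n, exists l : R[i]^o,
    c0_seq u n @[u --> F] --> l.
  move=> n; apply/cvg_ex; apply: complex_complete; apply/cauchyP => e e0.
  have [u Fu] := Fc _ e0; exists (c0_seq u n).
  suff : F (fun v => ball (c0_seq u n) e (c0_seq v n)) by [].
  apply: filterS Fu => v; rewrite -!ball_normE /=; apply: le_lt_trans.
  exact: (c0_coord_le (u - v)).
have Fle (e : R[i]) : 0 < e ->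
    \forall u \near F, forall n, `|l n - c0_seq u n| <= e.
  move=> e0; have e20 : 0 < e / 2 by rewrite divr_gt0.
  have e40 : 0 < e / 2 / 2 by rewrite divr_gt0.
  have [w Fw] := Fc _ e40.
  apply: filterS (Fw) => u; rewrite -ball_normE /= => wu n.
  have /cvgrPdist_lt/(_ _ e20) Fn := Fl n.
  have [v [wv lv]] := @filter_ex _ _ FF _ (filterI Fw Fn).
  move: wv; rewrite -ball_normE /= => wv.
  rewrite -(subrKA (c0_seq v n)) (le_trans (ler_normD _ _))//.
  rewrite [leRHS]splitr lerD//; first exact: ltW.
  rewrite (le_trans (c0_coord_le (v - u) n))//.
  rewrite -(subrKA w) (le_trans (ler_normD _ _))// [leRHS]splitr.
  by rewrite lerD// ltW// distrC.
have l0 : l \in null_seq.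
  apply/asboolP/cvgrPdist_le => e e0.
  have e20 : 0 < e / 2 by rewrite divr_gt0.
  have [u lu] := @filter_ex _ _ FF _ (Fle _ e20).
  have /cvgrPdist_le/(_ _ e20) := c0P u.
  apply: filterS => n; rewrite !sub0r !normrN => un.
  rewrite -(subrK (c0_seq u n) (l n)) (le_trans (ler_normD _ _))//.
  by rewrite [leRHS]splitr lerD.
apply/cvg_ex; exists (C0 l0); apply/cvgrPdist_le => e e0.
have eE : e = (complex.Re e)%:C by rewrite RRe_real// gtr0_real.
apply: filterS (Fle _ e0) => u lu.
rewrite c0_normE eE lecR; apply: c0_sup_le => n.
by rewrite -lecR -rnormE -eE; exact: lu.
Qed.

HB.instance Definition _ := Uniform_isComplete.Build c0 c0_complete.

End c0.
Arguments c0 R : clear implicits.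

Section operators.
Context {R : realType}.
Implicit Types F G : normedModType R[i].

Definition closed_unit_ball F : set F := [set x | `|x| <= 1].
Arguments closed_unit_ball F _ : clear implicits.

Definition opnorm F G (A : {linear F -> G}) : R :=
  sup [set rnorm (A x) | x in closed_unit_ball F].

Definition separable_set (T : topologicalType) (S : set T) : Prop :=
  exists D : set T, [/\ countable D, D `<=` S & S `<=` closure D].

Definition separable_operator F G (A : {linear F -> G}) : Prop :=
  continuous A /\ separable_set (A @` closed_unit_ball F).

Definition dual F : Type := {phi : {linear F -> R[i]^o} | continuous phi}.

HB.instance Definition _ F := gen_eqMixin (dual F).
HB.instance Definition _ F := gen_choiceMixin (dual F).

Definition dual_eval F (x : F) : {ptws dual F -> R[i]^o} :=
  fun phi => sval phi x.

Definition weak_space F : Type := initial_topology (@dual_eval F).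

Definition relatively_weakly_compact F (K : set F) : Prop :=
  precompact (K : set (weak_space F)).

Definition grothendieck_set F (K : set F) : Prop :=
  forall T : {linear F -> c0 R}, continuous T ->
    relatively_weakly_compact (T @` K).

End operators.
Arguments closed_unit_ball {R} F _.

(* Mappings U -> F are represented by total functions E -> F of which only the
   restriction to U matters. *)
Section weighted_holomorphic.
Context {R : realType} {E : completeNormedModType R[i]}.
Implicit Types (U : set E) (v : E -> R) (F : completeNormedModType R[i]).

Definition weight U v : Prop :=
  (forall x, U x -> 0 < v x) /\ {within U, continuous v}.

(* differentiable is Frechet differentiability over the scalars of the spaces,
   hence complex differentiability here *)
Definition holomorphic_on U F (f : E -> F) : Prop :=
  forall x, U x -> differentiable f x.

Definition weighted_norms U v F (f : E -> F) : set R :=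
  [set v x * rnorm (f x) | x in U].

(* sup is 0 on the empty set and on unbounded sets; the former gives the norm
   of the unique mapping on U = set0 *)
Definition weighted_norm U v F (f : E -> F) : R := sup (weighted_norms U v f).

Definition weighted_image U v F (f : E -> F) : set F :=
  [set (v x)%:C *: f x | x in U].

Definition Hv U v F : set (E -> F) :=
  [set f | holomorphic_on U f /\ has_ubound (weighted_norms U v f)].

Arguments Hv : clear implicits.

Definition HvO U v F : set (E -> F) :=
  [set f | Hv U v F f /\ grothendieck_set (weighted_image U v f)].

Arguments HvO : clear implicits.

Definition HvKw U v F : set (E -> F) :=
  [set f | Hv U v F f /\ relatively_weakly_compact (weighted_image U v f)].

Arguments HvKw : clear implicits.

Definition SHvKw U v F : set (E -> F) :=
  [set f | Hv U v F f /\
    forall (G : completeNormedModType R[i]) (A : {linear F -> G}),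
      separable_operator A -> HvKw U v G (A \o f)].

Arguments SHvKw : clear implicits.

Definition SHvKw_norm U v F (f : E -> F) : R :=
  sup [set r | exists (G : completeNormedModType R[i]) (A : {linear F -> G}),
    [/\ separable_operator A, opnorm A <= 1 & r = weighted_norm U v (A \o f)]].

End weighted_holomorphic.

Arguments Hv {R E} U v F _.
Arguments HvO {R E} U v F _.
Arguments HvKw {R E} U v F _.
Arguments SHvKw {R E} U v F _.

(* Main.v *)
(* One inclusion is immediate because c_0 is separable. For the other one, let K
   be a bounded Grothendieck subset of F, A : F -> G a separable operator and
   (d_k) dense in the image of the unit ball. A pointwise limit L of evaluations
   at points of A K is a linear functional on the dual of G. If functionals phi_n
   in the dual unit ball vanish at d_0, ..., d_(n-1), then x |-> (phi_n (A x))_n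
   maps F into c_0, and the Grothendieck property forces L phi_n -> 0. Hence L is
   uniformly small on the annihilators of d_0, ..., d_(n-1), so by Helly's
   argument L is a norm limit of evaluations, hence an evaluation at a point of
   G. Tychonoff's theorem then gives the weak compactness of the closure of A K.
   The norms agree because norming functionals z |-> phi z e_0 : F -> c_0 are
   separable operators. *)
Require Import Defs.
From HB Require Import structures.
From mathcomp Require Import all_boot all_order all_algebra.
From mathcomp Require Import all_classical all_reals all_analysis.
From mathcomp Require Import ring lra.

Set Implicit Arguments.
Unset Strict Implicit.
Unset Printing Implicit Defensive.

Import Order.TTheory GRing.Theory Num.Theory.
Import numFieldNormedType.Exports.

Local Open Scope classical_set_scope.
Local Open Scope ring_scope.

(** * Real Hahn-Banach theorem for a sublinear functional *)

Section hahn_banach_real.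
Variables (R : realType) (V : lmodType R) (p : V -> R).
Hypothesis pD : forall x y, p (x + y) <= p x + p y.
Hypothesis pZ : forall (a : R) x, 0 < a -> p (a *: x) = a * p x.

(** Partial functionals are represented by graphs, ordered by inclusion as Zorn's lemma requires;
    domination by [p] forces such a graph to be single-valued. *)
Definition dominated_linear_graph (g : set (V * R)) :=
  (forall a z w, g z -> g w -> g (a *: z.1 + w.1, a * z.2 + w.2)) /\
  (forall z, g z -> z.2 <= p z.1).

Let extend_graph (g : set (V * R)) (x : V) (c : R) : set (V * R) :=
  [set w | exists z a, g z /\ w = (z.1 + a *: x, z.2 + a * c)].

(** A value at [x] must dominate every [z.2 - p (z.1 - x)] and stay below every [p (w.1 + x) - w.2].
    Subadditivity of [p] orders these bounds, and [c] is the supremum of the lower ones. *)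
Lemma dominated_graph_extend (g : set (V * R)) (x : V) :
  dominated_linear_graph g -> g (0, 0) ->
  exists2 h, dominated_linear_graph h & g `<=` h /\ exists c, h (x, c).
Proof.
move=> [glin gp] g0.
have gS a z : g z -> g (a *: z.1, a * z.2).
  by move=> gz; have := glin a z (0, 0) gz g0; rewrite /= !addr0.
have gap z w : g z -> g w -> z.2 - p (z.1 - x) <= p (w.1 + x) - w.2.
  move=> gz gw; rewrite lerBlDr addrAC lerBrDr.
  have := gp _ (glin 1 z w gz gw); rewrite /= scale1r mul1r => /le_trans; apply.
  by rewrite -[z.1](subrK x) -addrA [x + _]addrC [leRHS]addrC subrK; exact: pD.
pose c := sup [set z.2 - p (z.1 - x) | z in g].
have cge z : g z -> z.2 - p (z.1 - x) <= c.
  move=> gz; apply: ub_le_sup; last by exists z.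
  by exists (p (0 + x) - 0) => _ [w gw <-]; exact: (gap w (0, 0)).
have cle z : g z -> c <= p (z.1 + x) - z.2.
  move=> gz; apply: ge_sup; first by exists (0 - p (0 - x)), (0, 0).
  by move=> _ [w gw <-]; exact: gap.
exists (extend_graph g x c); split.
- move=> a _ _ [z [b [gz ->]]] [w [b' [gw ->]]].
  exists (a *: z.1 + w.1, a * z.2 + w.2), (a * b + b').
  split; first exact: glin.
  congr pair => /=; last by ring.
  by rewrite scalerDr scalerA scalerDl addrACA.
(* Dividing by the absolute value of [a] reduces [a > 0] to the upper bound on [c] and [a < 0] to
   the lower one. *)
- move=> _ [z [a [gz ->]]] /=; have [a0|a0|->] := ltgtP a 0; last first.
  + by rewrite scale0r mul0r !addr0; exact: gp.
  + have := cle _ (gS a^-1 _ gz); rewrite /= -(ler_pM2l a0) mulrBr mulrA.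
    rewrite divff ?gt_eqF// mul1r -pZ// scalerDr scalerA divff ?gt_eqF//.
    by rewrite scale1r lerBrDl.
  + have b0 : 0 < - a by rewrite oppr_gt0.
    have := cge _ (gS (- a)^-1 _ gz); rewrite /= -(ler_pM2l b0) mulrBr mulrA.
    rewrite divff ?gt_eqF// mul1r -pZ// scalerBr scalerA divff ?gt_eqF//.
    by rewrite scale1r scaleNr opprK mulNr; lra.
- by move=> z gz; exists z, 0; rewrite scale0r mul0r !addr0 -surjective_pairing.
- exists c, (0, 0), 1; split => //=; by rewrite !add0r scale1r mul1r.
Qed.

(** Zorn's lemma yields a maximal graph above that of [f] on [W]; the one-dimensional extension
    shows that its domain is all of [V]. *)
Lemma hahn_banach_real (W : set V) (f : V -> R) :
  W 0 -> (forall a x y, W x -> W y -> W (a *: x + y)) ->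
  (forall a x y, W x -> W y -> f (a *: x + y) = a * f x + f y) ->
  (forall x, W x -> f x <= p x) ->
  exists g : V -> R, [/\ forall a x y, g (a *: x + y) = a * g x + g y,
    forall x, W x -> g x = f x & forall x, g x <= p x].
Proof.
move=> W0 Wlin flin fp.
pose g0 : set (V * R) := [set (x, f x) | x in W].
have f0 : f 0 = 0.
  by have := flin 1 0 0 W0 W0; rewrite scale1r mul1r addr0; lra.
have dg0 : dominated_linear_graph g0.
  split; last by move=> _ [x Wx <-]; exact: fp.
  move=> a _ _ [x Wx <-] [y Wy <-]; exists (a *: x + y); first exact: Wlin.
  by rewrite flin.
(* The empty chain has union [set0], which must satisfy [P]; hence containment of [g0] is asked of
   nonempty graphs only. *)
pose P g := dominated_linear_graph g /\ (g !=set0 -> g0 `<=` g).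
have [|g [[dg gg0] gmax]] := @Zorn_bigcup _ P.
  move=> C CP Ctot; split; [split|].
  - move=> a z w [g Cg gz] [h Ch hw].
    have [gh|hg] := Ctot g h Cg Ch.
      by exists h => //; apply: (CP _ Ch).1.1 => //; exact: gh.
    by exists g => //; apply: (CP _ Cg).1.1 => //; exact: hg.
  - by move=> z [g Cg gz]; exact: (CP _ Cg).1.2.
  - move=> [z [g Cg gz]] w w0; exists g => //.
    by apply: (CP _ Cg).2 => //; exists z.
have g00 : g0 (0, 0) by exists 0; rewrite // f0.
have gne : g !=set0.
  apply/set0P/negP => /eqP gE.
  apply: (gmax g0); rewrite ?gE; last by split => // _ x.
  by split => // /(_ _ g00).
have {}gg0 := gg0 gne.
have gT x : exists c, g (x, c).
  have [h dh [gh [c hc]]] := dominated_graph_extend x dg (gg0 _ g00).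
  apply: contrapT => gx; apply: (gmax h).
    by split => // hg; apply: gx; exists c; exact: hg.
  split => // _; exact: subset_trans gh.
have [k gk] := choice gT.
(* Subtracting the two pairs gives points of [g] over 0, whose values are at most [p 0 <= 0]. *)
have guniq x c d : g (x, c) -> g (x, d) -> c = d.
  move=> gc gd; apply/eqP; rewrite eq_le.
  have p0 : p 0 <= 0.
    by have := pZ (0 : V) (ltr0Sn R 1); rewrite scaler0; lra.
  have := dg.2 _ (dg.1 (-1) _ _ gc gd); have := dg.2 _ (dg.1 (-1) _ _ gd gc).
  by rewrite /= !scaleN1r addNr; lra.
exists k; split.
- by move=> a x y; apply: guniq (gk _) _; exact: (dg.1 a _ _ (gk x) (gk y)).
- by move=> x Wx; apply: guniq (gk _) _; apply: gg0; exists x.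
- by move=> x; exact: dg.2 _ (gk x).
Qed.

End hahn_banach_real.

(** * Complex Hahn-Banach theorem by restriction of scalars *)

Section complex_modules.
Variable R : realType.
Local Open Scope complex_scope.

(** An alias for [V], so that the real scalar action does not collide with the complex one. *)
Definition as_real_module (V : lmodType R[i]) : Type := V.

HB.instance Definition _ (V : lmodType R[i]) :=
  GRing.Zmodule.on (as_real_module V).

Section as_real_module.
Variable V : lmodType R[i].

Let real_scale (a : R) (x : as_real_module V) : as_real_module V :=
  a%:C *: (x : V).

Let real_scaleA a b x : real_scale a (real_scale b x) = real_scale (a * b) x.
Proof. by rewrite /real_scale scalerA -rmorphM. Qed.

Let real_scale1 : left_id 1 real_scale.
Proof. by move=> x; rewrite /real_scale scale1r. Qed.

Let real_scaleDr : right_distributive real_scale +%R.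
Proof. by move=> a x y; rewrite /real_scale scalerDr. Qed.

Let real_scaleDl x : {morph real_scale^~ x : a b / a + b}.
Proof. by move=> a b; rewrite /real_scale rmorphD scalerDl. Qed.

HB.instance Definition _ := GRing.Zmodule_isLmodule.Build R (as_real_module V)
  real_scaleA real_scale1 real_scaleDr real_scaleDl.

Lemma as_real_module_scaleE (a : R) (x : as_real_module V) :
  a *: x = a%:C *: (x : V).
Proof. by []. Qed.

End as_real_module.

Lemma complexE_Re_i (z : R[i]) :
  z = (complex.Re z)%:C - 'i%C * (complex.Re ('i%C * z))%:C.
Proof. by case: z => a b; simpc; rewrite ?opprK ?subr0 ?addr0 ?add0r. Qed.

(** The real theorem extends the real part of [f] to [h], and the complex functional is rebuilt from
    [h]. *)
Lemma hahn_banach_complex (V : lmodType R[i]) (p : V -> R) (W : set V)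
    (f : V -> R[i]) :
  (forall x y, p (x + y) <= p x + p y) ->
  (forall a x, p (a *: x) = complex.Re `|a| * p x) ->
  W 0 -> (forall a x y, W x -> W y -> W (a *: x + y)) ->
  (forall a x y, W x -> W y -> f (a *: x + y) = a * f x + f y) ->
  (forall x, W x -> complex.Re `|f x| <= p x) ->
  exists g : V -> R[i], [/\ forall a x y, g (a *: x + y) = a * g x + g y,
    forall x, W x -> g x = f x & forall x, complex.Re `|g x| <= p x].
Proof.
move=> pD pZ W0 Wlin flin fp.
have f0 : f 0 = 0.
  have := flin 1 0 0 W0 W0; rewrite scale1r mul1r addr0.
  by move=> /(congr1 (+%R (- f 0))); rewrite addKr addNr.
have fZ a x : W x -> f (a *: x) = a * f x.
  by move=> Wx; have := flin a x 0 Wx W0; rewrite !addr0 f0 addr0.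
have WZ a x : W x -> W (a *: x).
  by move=> Wx; have := Wlin a x 0 Wx W0; rewrite addr0.
have [||||h [hlin hf hp]] := @hahn_banach_real R (as_real_module V) p pD _ W
    (fun x => complex.Re (f x)) W0.
- move=> a x a0; rewrite as_real_module_scaleE pZ norm_real_complex.
  by rewrite gtr0_norm.
- by move=> a x y Wx Wy; rewrite as_real_module_scaleE; exact: Wlin.
- move=> a x y Wx Wy; rewrite as_real_module_scaleE flin// raddfD/=.
  by case: (f x) => u w; simpc.
- move=> x Wx; apply: le_trans (fp _ Wx); rewrite -lecR.
  rewrite (RRe_real (ger0_real (normr_ge0 (f x)))).
  by apply: le_trans (normc_ge_Re _); rewrite lecR ler_norm.
have {}hlin (a : R) (x y : V) : h (a%:C *: x + y) = a * h x + h y.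
  exact: (hlin a x y).
have h0 : h 0 = 0 by have := hlin 1 0 0; rewrite scale1r mul1r addr0; lra.
have hD (x y : V) : h (x + y) = h x + h y.
  by have := hlin 1 x y; rewrite scale1r mul1r.
have hZ (a : R) (x : V) : h (a%:C *: x) = a * h x.
  by have := hlin a x 0; rewrite !addr0 h0 addr0.
(* The only complex-linear functional with real part [h]; [complexE_Re_i] shows that it agrees with
   [f] on [W]. *)
pose g (x : V) : R[i] := (h x)%:C - 'i%C * (h ('i%C *: x))%:C.
have gD (x y : V) : g (x + y) = g x + g y.
  by rewrite /g scalerDr !hD !rmorphD/=; ring.
have gZR (a : R) x : g (a%:C *: x) = a%:C * g x.
  rewrite /g scalerA [_ * a%:C]mulrC -scalerA !hZ !rmorphM/=; ring.
have gi x : g ('i%C *: x) = 'i%C * g x.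
  rewrite /g scalerA -expr2 sqr_i scaleN1r.
  have -> : h (- x) = - h x.
    by have := hZ (-1) x; rewrite rmorphN1 scaleN1r mulN1r.
  rewrite rmorphN/= mulrBr mulrA -expr2 sqr_i; ring.
have gZ (a : R[i]) (x : V) : g (a *: x) = a * g x.
  rewrite [a]complexE scalerDl gD gZR -scalerA gi gZR; ring.
exists g; split.
- by move=> a x y; rewrite gD gZ.
- move=> x Wx; rewrite /g !hf ?fZ//; last exact: WZ.
  by rewrite -complexE_Re_i.
- move=> x; have [gx0|gx0] := eqVneq (g x) 0.
    rewrite gx0 normr0; have := pD x (-1 *: x).
    rewrite scaleN1r subrr -scaleN1r pZ normrN1 /=.
    by have := pZ 0 x; rewrite scale0r normr0 /=; lra.
  (* This unimodular factor makes the value real, so that it equals [h (a *: x)] and the bound on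
     [h] applies. *)
  pose a := `|g x| / g x.
  have gax : g (a *: x) = `|g x| by rewrite gZ divfK.
  have -> : complex.Re `|g x| = h (a *: x).
    rewrite -gax /g raddfB/=; simpc; ring.
  apply: le_trans (hp _) _; rewrite pZ normrM normfV normr_id.
  by rewrite divff ?normr_eq0//= mul1r.
Qed.

End complex_modules.

(** Induction on [n]: if some [z] is killed by the first [n] functionals but not by [ev n],
    subtracting a multiple of [ev n] from [f] reduces to the first [n]; otherwise [ev n] already
    vanishes on their common kernel. *)
Lemma lin_comb_of_common_kernel (K : fieldType) (V : lmodType K)
    (ev : nat -> V -> K) (f : V -> K) (n : nat) :
  (forall k a x y, ev k (a *: x + y) = a * ev k x + ev k y) ->
  (forall a x y, f (a *: x + y) = a * f x + f y) ->
  (forall x, (forall k, (k < n)%N -> ev k x = 0) -> f x = 0) ->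
  exists c : nat -> K, forall x, f x = \sum_(k < n) c k * ev k x.
Proof.
move=> evlin; elim: n f => [|n IH] f flin f0.
  by exists (fun=> 0) => x; rewrite big_ord0; exact: f0.
have [[z [z0 evz]]|nz] := pselect (exists z,
    (forall k, (k < n)%N -> ev k z = 0) /\ ev n z != 0).
  have [|x x0|c fc] := IH (fun x => f x - f z / ev n z * ev n x).
  - by move=> a x y; rewrite flin evlin; ring.
  - pose w := - (ev n x / ev n z) *: z + x.
    have : f w = 0.
      apply: f0 => k; rewrite ltnS leq_eqVlt => /orP[/eqP ->|kn].
        by rewrite evlin; field.
      by rewrite evlin (z0 k)// (x0 k)// mulr0 addr0.
    by rewrite flin => <-; field.
  exists (fun k => if k == n then f z / ev n z else c k) => x.
  rewrite big_ord_recr/= eqxx; apply/eqP; rewrite -subr_eq fc; apply/eqP.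
  by apply: eq_bigr => k _; rewrite ltn_eqF.
have [x x0|c fc] := IH f flin.
  apply: f0 => k; rewrite ltnS leq_eqVlt => /orP[/eqP ->|]; last exact: x0.
  by apply/eqP; apply: contra_notT nz => nx0; exists x.
exists (fun k => if k == n then 0 else c k) => x.
rewrite big_ord_recr/= eqxx mul0r addr0 fc.
by apply: eq_bigr => k _; rewrite ltn_eqF.
Qed.

(** * Real-valued norms and operator norms *)

Section rnorm_extra.
Variable R : realType.
Local Open Scope complex_scope.
Implicit Types F G : normedModType R[i].

Lemma rnormN F (x : F) : rnorm (- x) = rnorm x.
Proof. by rewrite /rnorm normrN. Qed.

Lemma rnorm0 F : rnorm (0 : F) = 0.
Proof. by rewrite /rnorm normr0. Qed.

Lemma rnorm_eq0 F (x : F) : rnorm x = 0 -> x = 0.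
Proof. by move=> x0; apply/normr0_eq0; rewrite rnormE x0. Qed.

Lemma rnorm_distC F (x y : F) : rnorm (x - y) = rnorm (y - x).
Proof. by rewrite /rnorm distrC. Qed.

Lemma rnorm_triangle F (z x y : F) :
  rnorm (x - y) <= rnorm (x - z) + rnorm (z - y).
Proof. by rewrite -{1}(subrKA z); exact: ler_rnormD. Qed.

Lemma cvg_rnormP F T (H : set_system T) (FH : Filter H) (f : T -> F) (l : F) :
  f @ H --> l <-> forall e : R, 0 < e -> \forall x \near H, rnorm (l - f x) < e.
Proof.
split => [/cvgrPdist_lt fl e e0|fl].
  have e0' : 0 < e%:C by rewrite ltcR.
  by apply: filterS (fl _ e0') => x; rewrite rnormE ltcR.
apply/cvgrPdist_lt => e e0.
have eE : e = (complex.Re e)%:C by rewrite RRe_real// gtr0_real.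
have e0' : 0 < complex.Re e by rewrite -ltcR -eE.
by apply: filterS (fl _ e0') => x; rewrite rnormE eE ltcR.
Qed.

Lemma continuous_linear_rnormP F G (A : {linear F -> G}) :
  continuous A <-> exists M : R, forall x, rnorm (A x) <= M * rnorm x.
Proof.
split.
  move/linear_bounded_continuous/linear_boundedP/pinfty_ex_gt0 => [r r0 Ar].
  have rE : r = (complex.Re r)%:C by rewrite RRe_real// gtr0_real.
  exists (complex.Re r) => x.
  by rewrite -lecR rmorphM/= -!rnormE -rE.
move=> [M AM]; apply/linear_bounded_continuous/bounded_funP => r.
exists (`|M|%:C * r) => x xr; rewrite (@le_trans _ _ (`|M|%:C * `|x|))//.
  rewrite !rnormE -rmorphM lecR (le_trans (AM x))//.
  by rewrite ler_wpM2r ?rnorm_ge0// ler_norm.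
by rewrite ler_wpM2l// lecR.
Qed.

Lemma opnorm_le F G (A : {linear F -> G}) (M : R) :
  0 <= M -> (forall x, rnorm (A x) <= M * rnorm x) -> opnorm A <= M.
Proof.
move=> M0 AM; apply: ge_sup.
  by exists (rnorm (A 0)), 0; rewrite // /closed_unit_ball/= normr0.
move=> _ [x x1 <-]; rewrite (le_trans (AM x))// ler_piMr//.
by move: x1; rewrite /closed_unit_ball/= rnormE -[1]/(1%:C) lecR.
Qed.

Lemma opnorm_ge0 F G (A : {linear F -> G}) : 0 <= opnorm A.
Proof.
(* The supremum of an unbounded set is 0 by default. *)
have [Aub|Aub] := pselect (has_ubound
    [set rnorm (A x) | x in closed_unit_ball F]); last first.
  by rewrite /opnorm sup_out// => -[].
rewrite (le_trans (rnorm_ge0 (A 0)))// ub_le_sup//; exists 0 => //.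
by rewrite /closed_unit_ball/= normr0.
Qed.

Lemma opnorm_ge F G (A : {linear F -> G}) x :
  continuous A -> rnorm (A x) <= opnorm A * rnorm x.
Proof.
move=> /continuous_linear_rnormP[M AM].
have [x0|x0] := eqVneq (rnorm x) 0.
  by rewrite x0 mulr0 -(mulr0 M) -x0; exact: AM.
have xgt0 : 0 < rnorm x by rewrite lt0r x0 rnorm_ge0.
rewrite -ler_pdivrMr//; apply: ub_le_sup.
  exists `|M| => _ [y y1 <-]; rewrite (le_trans (AM y))//.
  rewrite (le_trans (ler_wpM2r (rnorm_ge0 y) (ler_norm M)))// ler_piMr//.
  by move: y1; rewrite /closed_unit_ball/= rnormE -[1]/(1%:C) lecR.
exists ((rnorm x)^-1%:C *: x).
  rewrite /closed_unit_ball/= rnormE rnormZ norm_real_complex/=.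
  by rewrite ger0_norm ?invr_ge0 ?rnorm_ge0// mulVf.
rewrite linearZ rnormZ norm_real_complex/=.
by rewrite ger0_norm ?invr_ge0 ?rnorm_ge0// mulrC.
Qed.

End rnorm_extra.

(** * The dual as a module, and norming functionals *)

Section bounded_dual.
Variable R : realType.
Local Open Scope complex_scope.
Variable G : normedModType R[i].

Definition bounded_functional : {pred (G -> R[i]^o)} :=
  [pred f : G -> R[i]^o |
    `[< linear f /\ exists M : R, forall x, rnorm (f x) <= M * rnorm x >]].

(* The functionals of [dual G], which carries no module structure, as a module. *)
Record bdual : Type := BDual {
  bdual_fun : G -> R[i]^o ;
  bdual_funP : bdual_fun \in bounded_functional }.

HB.instance Definition _ := [isSub for bdual_fun].
HB.instance Definition _ := [Choice of bdual by <:].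

Lemma bounded_functional_submod : submod_closed bounded_functional.
Proof.
split => [|a u v /asboolP[ul [M uM]] /asboolP[vl [N vN]]]; apply/asboolP.
  split => [a x y|]; first by rewrite ?fctE scaler0 addr0.
  by exists 0 => x; rewrite mul0r -[0 x]/(0 : R[i]^o) rnorm0.
split => [b x y|].
  rewrite !fctE ul vl !scalerDr !scalerA [b * a]mulrC.
  by rewrite -!addrA; congr (_ + _); rewrite addrCA.
exists (complex.Re `|a| * M + N) => x; rewrite !fctE (le_trans (ler_rnormD _ _))//.
rewrite mulrDl lerD// rnormZ -mulrA ler_wpM2l//.
by rewrite -[complex.Re _]/(rnorm (a : R[i]^o)) rnorm_ge0.
Qed.

HB.instance Definition _ := GRing.isSubmodClosed.Build R[i] (G -> R[i]^o)
  bounded_functional bounded_functional_submod.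
HB.instance Definition _ := [SubChoice_isSubLmodule of bdual by <:].

Definition bdual_linear_fun (phi : bdual) : G -> R[i]^o := bdual_fun phi.

Lemma bdual_linear_subproof (phi : bdual) : linear (bdual_linear_fun phi).
Proof. by case: phi => u /= /asboolP[]. Qed.

HB.instance Definition _ (phi : bdual) :=
  GRing.isLinear.Build R[i] G R[i]^o _ (bdual_linear_fun phi)
    (bdual_linear_subproof phi).

Definition bdual_linear (phi : bdual) : {linear G -> R[i]^o} :=
  bdual_linear_fun phi.

Coercion bdual_linear : bdual >-> GRing.Linear.type.

Lemma bdual_continuous (phi : bdual) : continuous phi.
Proof.
by apply/continuous_linear_rnormP; case: phi => u /= /asboolP[].
Qed.

Lemma bdual_linearP (a : R[i]) (phi psi : bdual) x :
  (a *: phi + psi) x = a * phi x + psi x.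
Proof. by []. Qed.

Lemma bdual_exists (f : G -> R[i]) (M : R) :
  (forall a x y, f (a *: x + y) = a * f x + f y) ->
  (forall x, rnorm (f x : R[i]^o) <= M * rnorm x) ->
  exists phi : bdual, forall x, phi x = f x.
Proof.
move=> fl fM; have fP : (f : G -> R[i]^o) \in bounded_functional.
  by apply/asboolP; split; [exact: fl|exists M].
by exists (BDual fP).
Qed.

(** Hahn-Banach extends [a *: y |-> a * rnorm y] from the line through [y]. *)
Lemma norming_functional (y : G) :
  exists phi : bdual, opnorm phi <= 1 /\ phi y = (rnorm y)%:C.
Proof.
pose W := [set x | exists a : R[i], x = a *: y].
have /choice[c cP] : forall x, exists a : R[i], W x -> x = a *: y.
  move=> x; have [[a ->]|nW] := pselect (W x); first by exists a.
  by exists 0.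
(* The coefficient [a] is ambiguous when [y = 0], but its product with [rnorm y] is not. *)
have cancel_y (a b : R[i]) : a *: y = b *: y -> a * (rnorm y)%:C = b * (rnorm y)%:C.
  move=> ab; apply/eqP; rewrite -subr_eq0 -mulrBl -normr_eq0 normrM -rnormE.
  by rewrite normr_id -normrZ scalerBl ab subrr normr0.
have Wl a x z : W x -> W z -> W (a *: x + z).
  move=> [b ->] [b' ->]; exists (a * b + b').
  by rewrite scalerDl scalerA.
have Wy : W y by exists 1; rewrite scale1r.
have [||||||g [gl gf gp]] := @hahn_banach_complex R G (@rnorm R G) W
    (fun x => c x * (rnorm y)%:C).
- exact: ler_rnormD.
- exact: rnormZ.
- by exists 0; rewrite scale0r.
- exact: Wl.
- move=> a x z Wx Wz; rewrite mulrA -mulrDl; apply: cancel_y.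
  by rewrite -cP; [rewrite scalerDl -scalerA -!cP|exact: Wl].
- move=> x Wx; rewrite normrM -rnormE normr_id -normrZ -cP//.
have [|phi phiE] := @bdual_exists g 1 gl; first by move=> x; rewrite mul1r; exact: gp.
exists phi; split.
  by apply: opnorm_le => // x; rewrite mul1r phiE; exact: gp.
rewrite phiE gf// -[RHS]mul1r; apply: cancel_y.
by rewrite -cP// scale1r.
Qed.

End bounded_dual.

(** * Helly's argument: functionals on the dual that are evaluations *)

Section representation.
Variable R : realType.
Local Open Scope complex_scope.

Lemma opnorm_bdual_ge (G : normedModType R[i]) (phi : bdual G) x :
  rnorm (phi x) <= opnorm phi * rnorm x.
Proof. by apply: opnorm_ge; exact: bdual_continuous. Qed.

Lemma bdual_eq0 (G : normedModType R[i]) (phi : bdual G) :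
  opnorm phi = 0 -> phi = 0.
Proof.
move=> phi0; apply: val_inj; apply/funext => x; apply: rnorm_eq0.
apply/eqP; rewrite eq_le rnorm_ge0 andbT.
by have := opnorm_bdual_ge phi x; rewrite phi0 mul0r.
Qed.

Lemma opnormD (G : normedModType R[i]) (phi psi : bdual G) :
  opnorm (phi + psi : bdual G) <= opnorm phi + opnorm psi.
Proof.
apply: opnorm_le => [|x]; first by rewrite addr_ge0 ?opnorm_ge0.
rewrite mulrDl (le_trans (ler_rnormD _ _))// lerD//;
  exact: opnorm_bdual_ge.
Qed.

Lemma opnormZ (G : normedModType R[i]) (a : R[i]) (phi : bdual G) :
  opnorm (a *: phi : bdual G) = complex.Re `|a| * opnorm phi.
Proof.
have le_opnormZ (b : R[i]) (psi : bdual G) :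
    opnorm (b *: psi : bdual G) <= complex.Re `|b| * opnorm psi.
  apply: opnorm_le => [|x].
    by rewrite mulr_ge0 ?opnorm_ge0//; exact: (rnorm_ge0 (b : R[i]^o)).
  rewrite -[X in rnorm X]/(b *: psi x) rnormZ -mulrA ler_wpM2l//.
    exact: (rnorm_ge0 (b : R[i]^o)).
  exact: opnorm_bdual_ge.
apply/eqP; rewrite eq_le le_opnormZ andTb.
have [aE|a0] := eqVneq a 0.
  have -> : complex.Re `|a| = 0 by rewrite aE normr0.
  by rewrite mul0r opnorm_ge0.
have a_gt0 : 0 < complex.Re `|a|.
  by rewrite -ltcR (RRe_real (ger0_real (normr_ge0 a))) normr_gt0.
have := le_opnormZ a^-1 (a *: phi); rewrite scalerA mulVf// scale1r normfV.
have -> : complex.Re `|a|^-1 = (complex.Re `|a|)^-1.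
  by rewrite -{1}[`|a|](RRe_real (ger0_real (normr_ge0 a))) -fmorphV.
by rewrite ler_pdivlMl.
Qed.

Variable G : completeNormedModType R[i].
Implicit Types phi psi : bdual G.

Lemma rnorm_le_functional (y : G) (M : R) :
  (forall phi, opnorm phi <= 1 -> rnorm (phi y) <= M) -> rnorm y <= M.
Proof.
move=> yM; have [phi [phi1 phiy]] := norming_functional y.
have := yM _ phi1; rewrite phiy {1}/rnorm norm_real_complex/=.
by rewrite ger0_norm ?rnorm_ge0.
Qed.

Section approximation.
Variables (L : bdual G -> R[i]) (d : nat -> G).
Hypothesis L_linear :
  forall a phi psi, L (a *: phi + psi) = a * L phi + L psi.

(* Helly: a functional on the dual which is small on the annihilator of
   finitely many points is close to an evaluation at a combination of them. *)
Lemma near_evaluation (e : R) (n : nat) : 0 <= e ->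
  (forall phi, opnorm phi <= 1 ->
     (forall k, (k < n)%N -> phi (d k) = 0) -> rnorm (L phi : R[i]^o) <= e) ->
  exists y : G, forall phi, rnorm (L phi - phi y : R[i]^o) <= e * opnorm phi.
Proof.
move=> e0 Ln.
have L0 : L 0 = 0.
  have := L_linear 1 0 0; rewrite scale1r mul1r addr0.
  by move=> /(congr1 (+%R (- L 0))); rewrite addKr addNr.
have LZ a phi : L (a *: phi) = a * L phi.
  by have := L_linear a phi 0; rewrite !addr0 L0 addr0.
pose W := [set phi : bdual G | forall k, (k < n)%N -> phi (d k) = 0].
(* The restriction of [L] to [W] extends to [g] with bound [e * opnorm phi]; then [L - g] vanishes
   on [W], so it is a combination of the evaluations at the [d k]. *)
have [||||||g [gl gL gp]] := @hahn_banach_complex R (bdual G)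
    (fun phi => e * opnorm phi) W L.
- by move=> x y; rewrite -mulrDr ler_wpM2l// opnormD.
- by move=> a x; rewrite opnormZ mulrCA.
- by move=> k _.
- by move=> a x y Wx Wy k kn; rewrite bdual_linearP Wx// Wy// mulr0 addr0.
- by move=> a x y _ _; exact: L_linear.
- move=> phi Wphi; have [phi0|phi0] := eqVneq (opnorm phi) 0.
    by rewrite (bdual_eq0 phi0) L0 normr0 mulr_ge0// opnorm_ge0.
  have phi_gt0 : 0 < opnorm phi by rewrite lt0r phi0 opnorm_ge0.
  have nV : complex.Re `|(opnorm phi)^-1%:C| = (opnorm phi)^-1.
    by rewrite norm_real_complex/= ger0_norm// invr_ge0 ltW.
  have := Ln ((opnorm phi)^-1%:C *: phi).
  rewrite opnormZ nV mulVf// LZ => /(_ (lexx _)).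
  rewrite -[_ * L phi]/(_ *: (L phi : R[i]^o)) rnormZ nV ler_pdivrMl// mulrC.
  apply=> k kn; rewrite -[LHS]/(_ *: phi (d k)) (Wphi k kn) scaler0//.
have [| |phi phi0|c cE] := @lin_comb_of_common_kernel R[i] (bdual G)
    (fun k phi => phi (d k)) (fun phi => L phi - g phi) n.
- by move=> k a x y; rewrite bdual_linearP.
- by move=> a x y; rewrite gl L_linear; ring.
- by rewrite gL ?subrr.
exists (\sum_(k < n) c k *: d k) => phi.
have -> : L phi - phi (\sum_(k < n) c k *: d k) = g phi; last exact: gp.
apply/eqP; rewrite subr_eq addrC -subr_eq cE linear_sum; apply/eqP.
by apply: eq_bigr => k _; rewrite linearZ.
Qed.

(** By [near_evaluation] with errors 1/(n+1), [L] is approximated in norm by evaluations at points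
    [y n]; these form a Cauchy sequence, whose limit in the complete space [G] represents [L]. *)
Lemma evaluation_of_null_seq :
  (forall phi_ : nat -> bdual G, (forall n, opnorm (phi_ n) <= 1) ->
    (forall n k, (k < n)%N -> phi_ n (d k) = 0) ->
    (fun n => L (phi_ n) : R[i]^o) @ \oo --> (0 : R[i]^o)) ->
  exists y : G, forall phi, L phi = phi y.
Proof.
move=> Lnull.
have small (e : R) : 0 < e -> exists n, forall phi, opnorm phi <= 1 ->
    (forall k, (k < n)%N -> phi (d k) = 0) -> rnorm (L phi : R[i]^o) <= e.
  (* Otherwise each [n] provides a functional of norm at most 1 that kills the first [n] points and
     at which [L] exceeds [e] in modulus; this sequence contradicts [Lnull]. *)
  move=> e0; apply: contrapT => /forallNP nsmall.
  have /choice[phi_ phi_P] n : exists phi, [/\ opnorm phi <= 1,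
      forall k, (k < n)%N -> phi (d k) = 0 & e < rnorm (L phi : R[i]^o)].
    have /existsNP[phi /not_implyP[p1 /not_implyP[pd /negP]]] := nsmall n.
    by rewrite -ltNge => pe; exists phi.
  have /cvg_rnormP := Lnull phi_ (fun n => let: And3 a _ _ := phi_P n in a)
    (fun n => let: And3 _ a _ := phi_P n in a).
  move=> /(_ _ e0)[N _ /(_ N (leqnn N))]; rewrite /= sub0r rnormN.
  by case: (phi_P N) => _ _ /ltW; rewrite leNgt => /negP.
have /choice[y yP] n : exists y : G,
    forall phi, rnorm (L phi - phi y : R[i]^o) <= n.+1%:R^-1 * opnorm phi.
  have n0 : 0 < n.+1%:R^-1 :> R by rewrite invr_gt0.
  by have [m /(near_evaluation (ltW n0))] := small _ n0.
have ydist m n : rnorm (y m - y n) <= m.+1%:R^-1 + n.+1%:R^-1.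
  apply: rnorm_le_functional => phi phi1; rewrite linearB.
  rewrite (le_trans (rnorm_triangle (L phi : R[i]^o) _ _))// lerD//.
    by rewrite rnorm_distC (le_trans (yP _ _))// ler_piMr.
  by rewrite (le_trans (yP _ _))// ler_piMr.
have inv_small (e : R) : 0 < e -> \forall n \near \oo, n.+1%:R^-1 < e.
  by move=> e0; exact: near_infty_natSinv_lt (PosNum e0).
have /cauchy_cvgP/cvg_ex[z yz] : cauchy (y @ \oo).
  apply/cauchyP => e e0.
  have eE : e = (complex.Re e)%:C by rewrite RRe_real// gtr0_real.
  have e20 : 0 < complex.Re e / 2 by rewrite divr_gt0// -ltcR -eE.
  have /= [N _ NP] := inv_small _ e20.
  exists (y N); exists N => // n /= Nn.
  rewrite -ball_normE /= eE rnormE ltcR (le_lt_trans (ydist _ _))//.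
  by rewrite [ltRHS]splitr ltrD// NP/=.
exists z => phi; apply: (@subr0_eq R[i]); apply: (@rnorm_eq0 _ R[i]^o).
apply/eqP; rewrite eq_le rnorm_ge0 andbT; apply/ler_addgt0Pr => e e0.
rewrite add0r.
have k0 : 0 < opnorm phi + 1 by rewrite ltr_wpDl// opnorm_ge0.
have ek0 : 0 < e / (opnorm phi + 1) / 2 by rewrite !divr_gt0.
have /cvg_rnormP/(_ _ ek0) yzn := yz.
have [n [/= n1 n2]] := @filter_ex _ \oo _ _ (filterI (inv_small _ ek0) yzn).
rewrite (le_trans (rnorm_triangle (phi (y n) : R[i]^o) _ _))//.
rewrite -linearB.
rewrite (le_trans (lerD (yP n phi) (opnorm_bdual_ge phi _)))//.
rewrite rnorm_distC mulrC -mulrDr.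
rewrite (@le_trans _ _ ((opnorm phi + 1) * (e / (opnorm phi + 1))))//; last first.
  by rewrite mulrCA divff ?gt_eqF// mulr1.
rewrite ler_pM ?opnorm_ge0 ?addr_ge0 ?invr_ge0 ?rnorm_ge0 ?lerDl//.
by rewrite [leRHS]splitr lerD// ltW.
Qed.

End approximation.
End representation.

(** * Weak topology and compactness of pointwise bounded families *)

Section weak_compactness.
Variable R : realType.
Local Open Scope complex_scope.

Lemma linear_of_function (V W : lmodType R[i]) (f : V -> W) :
  linear f -> exists A : {linear V -> W}, forall x, A x = f x.
Proof.
move=> fl.
pose A : {linear V -> W} := HB.pack f (GRing.isLinear.Build _ _ _ _ f fl).
by exists A.
Qed.

Lemma nbhs_weak_space (F : normedModType R[i]) (phi : dual F) (u : F)
    (B : set R[i]^o) :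
  nbhs (sval phi u : R[i]^o) B ->
  nbhs (u : weak_space F) [set w : F | B (sval phi w)].
Proof.
move=> nB.
have : nbhs (dual_eval u) [set g | B (g phi)].
  exact: (@proj_continuous _ (fun _ : dual F => R[i]^o) phi (dual_eval u) _ nB).
exact: (@initial_continuous _ _ (@dual_eval R F) u).
Qed.

(** Such a set lies in the continuous image of a compact real square. *)
Lemma precompact_bounded_complex (S : set R[i]^o) (M : R) :
  (forall z, S z -> rnorm z <= M) -> precompact S.
Proof.
move=> SM; pose f (z : R * R) : R[i]^o := z.1%:C + 'i%C * z.2%:C.
pose Q := f @` (`[- M, M] `*` `[- M, M]).
have cf : continuous f.
  move=> z; apply/cvg_rnormP => e e0.
  have e20 : 0 < e / 2 by rewrite divr_gt0.
  have /cvgrPdist_lt/(_ _ e20) z1 : fst w @[w --> z] --> (z.1 : R^o).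
    exact: cvg_fst.
  have /cvgrPdist_lt/(_ _ e20) z2 : snd w @[w --> z] --> (z.2 : R^o).
    exact: cvg_snd.
  near=> w; rewrite /f opprD addrACA -mulrBr -!rmorphB/=.
  rewrite (le_lt_trans (ler_rnormD _ _))//.
  rewrite -ltcR rmorphD/= -!rnormE normrM normc_i mul1r !norm_real_complex.
  rewrite -rmorphD ltcR [ltRHS]splitr ltrD//; near: w; [exact: z1|exact: z2].
have cQ : compact Q.
  apply: continuous_compact; first exact: continuous_subspaceT.
  by apply: compact_setX; exact: segment_compact.
apply: (@precompact_subset _ _ Q) => [z /SM zM|]; last first.
  by apply: compact_precompact cQ; exact: norm_hausdorff.
exists (complex.Re z, complex.Im z); last first.
  by rewrite /f/= -complexE.
split => /=; rewrite in_itv/= -ler_norml (le_trans _ zM)// -lecR -rnormE.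
  exact: normc_ge_Re.
exact: normc_ge_Im.
Unshelve. all: by end_near. Qed.

(** Tychonoff's theorem for the product of the closures of the discs of radius [M i]. *)
Lemma precompact_pointwise_bounded (I : eqType)
    (S : set {ptws I -> R[i]^o}) (M : I -> R) :
  (forall g i, S g -> rnorm (g i) <= M i) -> precompact S.
Proof.
move=> SM; pose Q := [set g : {ptws I -> R[i]^o} |
  forall i, closure [set z : R[i]^o | rnorm z <= M i] (g i)].
have Qcompact : compact Q.
  have clc j : compact (closure [set z : R[i]^o | rnorm z <= M j]).
    by rewrite -precompactE; exact: (@precompact_bounded_complex _ (M j)).
  exact: (@tychonoff I (fun=> R[i]^o) _ clc).
apply: (@precompact_subset _ _ Q) => [g Sg i|].
  exact: (@subset_closure R[i]^o _ _ (SM g i Sg)).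
apply: compact_precompact Qcompact; apply: hausdorff_product => i.
exact: norm_hausdorff.
Qed.

(** The point [t0] fills the indices that code no element, so [D] may be finite or empty. *)
Lemma countable_enum (T : choiceType) (t0 : T) (D : set T) :
  countable D -> exists d : nat -> T, D `<=` range d.
Proof.
move=> /countable_injP[f finj].
have /choice[d dP] n : exists x, forall y, D y -> f y = n -> x = y.
  have [[y [Dy fy]]|nD] := pselect (exists y, D y /\ f y = n).
    by exists y => z Dz fz; apply: finj; rewrite ?inE// fz.
  by exists t0 => y Dy fy; exfalso; apply: nD; exists y.
by exists d => x Dx; exists (f x) => //; exact: dP.
Qed.

(** * Pointwise limits of evaluations at the image of a Grothendieck set *)

Section separable_image.
Variables (F : normedModType R[i]) (G : completeNormedModType R[i]).
Variables (A : {linear F -> G}) (K : set F).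
Hypotheses (Acont : continuous A) (Kgr : grothendieck_set K).

Variable d : nat -> G.
Hypothesis dense_d : A @` closed_unit_ball F `<=` closure (range d).

(** [phi n] kills [d k] for [n > k], so its value at a point of the image of the unit ball is at
    most the distance of that point to [d k], which density makes small; scaling covers all [x]. *)
Lemma null_on_dense (phi : nat -> bdual G) (x : F) :
  (forall n, opnorm (phi n) <= 1) ->
  (forall n k, (k < n)%N -> phi n (d k) = 0) ->
  (fun n => phi n (A x) : R[i]^o) @ \oo --> (0 : R[i]^o).
Proof.
move=> phi1 phi0.
pose c := rnorm x + 1.
have c0 : 0 < c by rewrite ltr_wpDl// rnorm_ge0.
pose x' := c^-1%:C *: x.
have nC (a : R) : 0 <= a -> complex.Re `|a%:C| = a.
  by move=> a0; rewrite norm_real_complex/= ger0_norm.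
have x'1 : closed_unit_ball F x'.
  rewrite /closed_unit_ball/= rnormE -[1]/(1%:C) lecR rnormZ.
  rewrite nC ?invr_ge0 ?(ltW c0)// ler_pdivrMl// mulr1.
  by rewrite /c lerDl.
have -> : x = c%:C *: x'.
  by rewrite scalerA -rmorphM divff ?gt_eqF// scale1r.
apply/cvg_rnormP => e e0.
have ec0 : 0 < e / c by rewrite divr_gt0.
have : closure (range d) (A x') by apply: dense_d; exists x'.
have ec0' : 0 < (e / c)%:C by rewrite ltcR.
move=> /(_ _ (nbhsx_ballx (A x') _ ec0'))[_ [[k _ <-]]].
rewrite -ball_normE/= rnormE ltcR => Adk.
exists k.+1 => // n /= kn; rewrite sub0r rnormN.
have -> : phi n (A (c%:C *: x')) = c%:C *: phi n (A x').
  by rewrite [A _]linearZ; exact: linearZ.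
rewrite rnormZ nC ?(ltW c0)//.
rewrite mulrC -ltr_pdivlMr//.
apply: le_lt_trans Adk; rewrite -[X in rnorm X]subr0 -(phi0 n k kn) -linearB.
by rewrite (le_trans (opnorm_bdual_ge _ _))// ler_piMl// rnorm_ge0.
Qed.

Definition eval_on (x : F) : {ptws dual G -> R[i]^o} := dual_eval (A x).

Definition to_dual (phi : bdual G) : dual G :=
  exist _ (phi : {linear G -> R[i]^o}) (@bdual_continuous R G phi).

Variable L : {ptws dual G -> R[i]^o}.
Hypothesis LK : closure (eval_on @` K) L.

(** The traces on [K] of the neighbourhoods of [L]: along this filter [phi (A x)] tends to [L phi]
    for every functional [phi]. *)
Let H : set_system F :=
  filter_from (nbhs L) (fun O => K `&` eval_on @^-1` O).

Let H_filter : ProperFilter H.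
Proof.
apply: filter_from_proper.
  apply: filter_from_filter; first by exists setT; exact: filterT.
  move=> B C nB nC; exists (B `&` C); first exact: filterI.
  by move=> x [Kx [Bx Cx]].
by move=> B /LK[_ [[x Kx <-] Bx]]; exists x.
Qed.

Let H_cvg (phi : dual G) :
  (fun x => sval phi (A x) : R[i]^o) @ H --> (L phi : R[i]^o).
Proof.
move=> B nB; exists [set g : {ptws dual G -> R[i]^o} | B (g phi)].
  exact: (@proj_continuous _ (fun _ : dual G => R[i]^o) phi L _ nB).
by move=> x [].
Qed.

Let H_unique (h : F -> R[i]^o) (z w : R[i]^o) :
  h @ H --> z -> h @ H --> w -> z = w.
Proof.
move=> hz hw.
exact: (@norm_cvg_unique _ R[i]^o _ (fmap_proper_filter h H_filter) z w hz hw).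
Qed.

Lemma closure_point_linear (a : R[i]) (phi psi : bdual G) :
  L (to_dual (a *: phi + psi)) = a * L (to_dual phi) + L (to_dual psi).
Proof.
have := @H_unique _ _ (a *: (L (to_dual phi) : R[i]^o) + L (to_dual psi))
  (@H_cvg (to_dual (a *: phi + psi))).
apply.
have FH : Filter H by case: H_filter.
have Hphi (xi : bdual G) :
    (fun x => xi (A x) : R[i]^o) @ H --> (L (to_dual xi) : R[i]^o).
  exact: (@H_cvg (to_dual xi)).
have aphi : (fun x => a *: (phi (A x) : R[i]^o)) @ H -->
    (a *: (L (to_dual phi) : R[i]^o)).
  exact: (@cvgZl_tmp R[i] R[i]^o _ _ FH _ _ _ (@Hphi phi)).
exact: (@cvgD R[i] R[i]^o _ _ FH _ _ _ _ aphi (@Hphi psi)).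
Qed.

(** By [null_on_dense], the sequences [phi n (A x)] define an operator [T] into c_0. The
    Grothendieck property gives the image of [H] under [T] a weak cluster point [u] in c_0, whose
    coordinates are the limits [L (to_dual (phi n))]; so these tend to 0. *)
Lemma closure_point_null_seq (phi : nat -> bdual G) :
  (forall n, opnorm (phi n) <= 1) ->
  (forall n k, (k < n)%N -> phi n (d k) = 0) ->
  (fun n => L (to_dual (phi n)) : R[i]^o) @ \oo --> (0 : R[i]^o).
Proof.
move=> phi1 phi0.
have Tnull x : (fun n => phi n (A x)) \in @null_seq R.
  by apply/asboolP; exact: null_on_dense.
have [|T TE] := @linear_of_function F (c0 R) (fun x => C0 (Tnull x)).
  move=> a x y; apply: val_inj; apply/funext => n.
  by rewrite /= linearP linearP.
have Tcont : continuous T.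
  have /continuous_linear_rnormP[M AM] := Acont.
  apply/continuous_linear_rnormP; exists M => x; rewrite TE.
  apply: c0_sup_le => n /=; rewrite (le_trans _ (AM x))//.
  rewrite (le_trans (opnorm_bdual_ge _ _))// ler_piMl ?rnorm_ge0//.
have [Q TKQ [Qcompact _]] := Kgr Tcont.
have FH : Filter H by case: H_filter.
have TH : ProperFilter (T @ H) by exact: fmap_proper_filter.
have THQ : (T @ H) Q.
  exists setT; first exact: filterT.
  by move=> x [Kx _]; apply: TKQ; exists x.
have [u [_ Tu]] := Qcompact (T @ H) TH THQ.
suff uE n : c0_seq u n = L (to_dual (phi n)).
  have -> : (fun n => L (to_dual (phi n)) : R[i]^o) = c0_seq u by apply/funext.
  exact: c0P.
(* The coordinate functional is weakly continuous, so the coordinate of [u] and the limit along [H]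
   can both be compared with that of a common [T x]. *)
have [|pi piE] := @linear_of_function (c0 R) R[i]^o (fun w => c0_seq w n).
  by move=> a x y.
have pi_cont : continuous pi.
  apply/continuous_linear_rnormP; exists 1 => w.
  by rewrite mul1r piE; exact: c0_sup_ge.
apply: (@subr0_eq R[i]); apply: (@rnorm_eq0 _ R[i]^o).
apply/eqP; rewrite eq_le rnorm_ge0 andbT; apply/ler_addgt0Pr => e e0.
rewrite add0r.
have e20 : 0 < e / 2 by rewrite divr_gt0.
have e20' : 0 < (e / 2)%:C by rewrite ltcR.
have := @nbhs_weak_space (c0 R) (exist _ pi pi_cont) u _
  (nbhsx_ballx (pi u : R[i]^o) _ e20').
have /cvg_rnormP/(_ _ e20) HLn := @H_cvg (to_dual (phi n)).
have : (T @ H) (T @` [set x |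
    rnorm (L (to_dual (phi n)) - sval (to_dual (phi n)) (A x) : R[i]^o) < e / 2]).
  exact: (@filterS _ H FH _ _ (@preimage_image _ _ T _) HLn).
move=> THn /(Tu _ _ THn)[_ [[x /= hx <-]]].
rewrite -ball_normE /= !piE TE /= rnormE ltcR => ux.
rewrite (le_trans (rnorm_triangle (phi n (A x) : R[i]^o) _ _))//.
by rewrite [leRHS]splitr lerD// ltW// rnorm_distC.
Qed.

Lemma closure_point_evaluation : exists y : G, L = dual_eval y.
Proof.
have [||y yE] := @evaluation_of_null_seq R G (fun phi => L (to_dual phi)) d.
- exact: closure_point_linear.
- exact: closure_point_null_seq.
exists y; apply/funext => phi.
have /continuous_linear_rnormP[M pM] := svalP phi.
have [|psi psiE] := @bdual_exists R G (sval phi) M _ pM.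
  by move=> a x z; rewrite linearP.
rewrite /dual_eval -psiE -yE.
(* [phi] and [to_dual psi] agree as functions, so [L] takes at both the limit of the same map along
   [H]. *)
apply: (H_unique (@H_cvg phi)).
have -> : (fun x => sval phi (A x)) = (fun x => psi (A x)).
  by apply/funext => x; rewrite psiE.
exact: (@H_cvg (to_dual psi)).
Qed.

End separable_image.

(** The weak topology is induced by evaluation into a product of scalars. There the image of [K] has
    compact closure, and every point of this closure is an evaluation at a point of [G], so cluster
    points pull back to [G]. *)
Lemma grothendieck_separable_image (F : normedModType R[i])
    (G : completeNormedModType R[i]) (A : {linear F -> G}) (K : set F) (M : R) :
  separable_operator A -> grothendieck_set K ->
  (forall x, K x -> rnorm x <= M) ->
  relatively_weakly_compact (A @` K).
Proof.
move=> [Acont [D [Dc DA AD]]] Kgr KM.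
have [d Dd] := countable_enum (0 : G) Dc.
have dense_d : A @` closed_unit_ball F `<=` closure (range d).
  by apply: subset_trans AD _; exact: closure_subset.
have : precompact ((@eval_on F G A @` K) : set {ptws dual G -> R[i]^o}).
  have /continuous_linear_rnormP[N' AN] := Acont.
  have /choice[n nP] (phi : dual G) :
      exists n : R, forall y, rnorm (sval phi y) <= n * rnorm y.
    exact/continuous_linear_rnormP/(svalP phi).
  apply: (@precompact_pointwise_bounded _ _ (fun phi => `|n phi| * (`|N'| * M))).
  move=> _ phi [x Kx <-]; rewrite (le_trans (nP phi _))//.
  rewrite (le_trans (ler_wpM2r (rnorm_ge0 _) (ler_norm (n phi))))// ler_wpM2l//.
  rewrite (le_trans (AN _))//.
  rewrite (le_trans (ler_wpM2r (rnorm_ge0 _) (ler_norm N')))// ler_wpM2l//.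
  exact: KM.
rewrite precompactE /relatively_weakly_compact precompactE => JKc.
pose J : weak_space G -> {ptws dual G -> R[i]^o} := @dual_eval R G.
have Jcont : continuous J by exact: initial_continuous.
have JJ : J @` (A @` K) = @eval_on F G A @` K.
  by rewrite image_comp.
move=> H HP HAK.
have JH : ProperFilter (J @ H) by exact: fmap_proper_filter.
have JHc : (J @ H) (closure (@eval_on F G A @` K)).
  apply: (@filterS _ H _ _ (J @^-1` _)) HAK => y yAK.
  rewrite -JJ => B nB; have [_ [[x Kx <-] Bx]] := yAK _ (@Jcont y B nB).
  by exists (J (A x)); split => //; exists (A x) => //; exists x.
have [L [JKL HL]] := JKc (J @ H) JH JHc.
have [y LE] := closure_point_evaluation Acont Kgr dense_d JKL.
(* As the topology is initial, weak neighbourhoods of [y] contain preimages of neighbourhoods of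
   [L]; so the cluster point [L] of the pushed filter makes [y] a cluster point of [H]. *)
have nbhsJ (B : set G) : nbhs (y : weak_space G) B ->
    exists2 V, nbhs L V & J @^-1` V `<=` B.
  move=> [_ [[V Vo <-] Vy] VB]; exists V => //.
  by rewrite LE; exact: open_nbhs_nbhs.
exists y; split.
  move=> B /nbhsJ[V nV VB]; have [_ [[x Kx <-] Vx]] := JKL _ nV.
  by exists (A x); split; [exists x|exact: VB].
move=> S B HS /nbhsJ[V nV VB].
have HJS : (J @ H) (J @` S).
  by apply: (@filterS _ H _ S (J @^-1` _)) HS; exact: preimage_image.
have [_ [[x Sx <-] Vx]] := HL (J @` S) V HJS nV.
by exists x; split => //; exact: VB.
Qed.

End weak_compactness.

(** * Separability of subsets of c_0 *)

Section separability.
Variable R : realType.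
Local Open Scope complex_scope.

Lemma c0_rnormE (u : c0 R) : rnorm u = c0_sup u.
Proof. by []. Qed.

Definition complex_of_rat2 (q : rat * rat) : R[i]^o :=
  (ratr q.1)%:C + 'i%C * (ratr q.2)%:C.

Lemma complex_of_rat2_dense (z : R[i]^o) (e : R) : 0 < e ->
  exists q, rnorm (z - complex_of_rat2 q) < e.
Proof.
move=> e0; have e20 : 0 < e / 2 by rewrite divr_gt0.
have near_rat (t : R) : exists q : rat, `|t - ratr q| < e / 2.
  have [|q] := @rat_in_itvoo R (t - e / 2) (t + e / 2); first by lra.
  by rewrite in_itv/= => /andP[h1 h2]; exists q; rewrite ltr_distlC; lra.
have [a aP] := near_rat (complex.Re z); have [b bP] := near_rat (complex.Im z).
exists (a, b); rewrite [z]complexE /complex_of_rat2/= opprD addrACA -mulrBr.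
rewrite -!rmorphB/= (le_lt_trans (ler_rnormD _ _))//.
rewrite -ltcR rmorphD/= -!rnormE normrM normc_i mul1r !norm_real_complex.
by rewrite -rmorphD ltcR [ltRHS]splitr ltrD.
Qed.

Lemma rat_seq_null (s : seq (rat * rat)) :
  (fun n => if (n < size s)%N then complex_of_rat2 (nth (0, 0) s n) else 0)
    \in @null_seq R.
Proof.
apply/asboolP/cvg_rnormP => e e0; exists (size s) => // n /= sn.
by rewrite ltnNge sn /= subrr rnorm0.
Qed.

(** Finitely supported sequences with Gaussian rational entries: a dense family indexed by a
    countable type. *)
Definition c0_of_rat_seq (s : seq (rat * rat)) : c0 R := C0 (rat_seq_null s).

Lemma c0_of_rat_seq_dense (u : c0 R) (e : R) : 0 < e ->
  exists s, rnorm (u - c0_of_rat_seq s) < e.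
Proof.
move=> e0; have e20 : 0 < e / 2 by rewrite divr_gt0.
have /cvg_rnormP/(_ _ e20)[N _ uN] := c0P u.
have /choice[q qP] n := complex_of_rat2_dense (c0_seq u n) e20.
exists (mkseq q N); apply: (@le_lt_trans _ _ (e / 2)); last by lra.
apply: (@c0_sup_le _ (u - c0_of_rat_seq (mkseq q N))) => n.
rewrite -[c0_seq _ n]/(c0_seq u n - c0_seq (c0_of_rat_seq _) n) /=.
rewrite size_mkseq; have [nN|Nn] := ltnP n N.
  by rewrite nth_mkseq// ltW//; exact: qP.
by rewrite -rnorm_distC ltW//; exact: uN.
Qed.

(** The approximating points must lie in [S]. For each rational sequence and radius 1/(m+1), a point
    of [S] within that radius is chosen if there is one; some such point comes within 2/(m+1) of any
    given element of [S]. *)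
Lemma separable_subset_c0 (S : set (c0 R)) : separable_set S.
Proof.
pose near_code (w : seq (rat * rat) * nat) (u : c0 R) :=
  S u /\ rnorm (u - c0_of_rat_seq w.1) < w.2.+1%:R^-1.
have [[u0 Su0]|S0] := pselect (S !=set0); last first.
  by exists set0; split => // u Su; exfalso; apply: S0; exists u.
have /choice[x xP] w : exists u, S u /\ ((exists u, near_code w u) -> near_code w u).
  have [[u uw]|nw] := pselect (exists u, near_code w u).
    by exists u; split => //; case: uw.
  by exists u0.
exists (range x); split.
- exact: (@sub_countable _ _ _ _ (card_image_le _ _)).
- by move=> _ [w _ <-]; case: (xP w).
- move=> u Su B /nbhs_ballP[e /= e0]; rewrite -ball_normE/= => uB.
  have eE : e = (complex.Re e)%:C by rewrite RRe_real// gtr0_real.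
  have e20 : 0 < complex.Re e / 2 by rewrite divr_gt0// -ltcR -eE.
  have [m _ /(_ m (leqnn m)) /= me] := near_infty_natSinv_lt (PosNum e20).
  have m0 : 0 < m.+1%:R^-1 :> R by rewrite invr_gt0.
  have [s us] := c0_of_rat_seq_dense u m0.
  exists (x (s, m)); split; first by exists (s, m).
  apply: uB => /=; rewrite eE rnormE ltcR.
  rewrite (le_lt_trans (rnorm_triangle (c0_of_rat_seq s) _ _))//.
  rewrite [ltRHS]splitr ltrD//; first exact: lt_trans us me.
  have [_ [|_]] := xP (s, m); first by exists u; split.
  by rewrite rnorm_distC => /lt_trans; apply.
Qed.

End separability.

(** * Equality of the spaces and of the norms *)

Section main.
Variables (R : realType) (E : completeNormedModType R[i]).
Local Open Scope complex_scope.
Variables (U : set E) (v : E -> R).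
Hypothesis vpos : forall x, U x -> 0 < v x.

Lemma weighted_image_comp (F G : completeNormedModType R[i])
    (A : {linear F -> G}) (f : E -> F) :
  weighted_image U v (A \o f) = A @` weighted_image U v f.
Proof.
rewrite /weighted_image image_comp; apply: eq_imagel => x Ux /=.
by rewrite linearZ.
Qed.

Lemma Hv_comp (F G : completeNormedModType R[i]) (A : {linear F -> G})
    (f : E -> F) : continuous A -> Hv U v F f -> Hv U v G (A \o f).
Proof.
move=> Acont [fhol [M fM]]; split.
  move=> x Ux; apply: differentiable_comp; first exact: fhol.
  exact: linear_differentiable.
exists (opnorm A * M) => _ [x Ux <-].
rewrite (@le_trans _ _ (v x * (opnorm A * rnorm (f x))))//.
  by rewrite ler_wpM2l ?(ltW (vpos Ux))//; exact: opnorm_ge.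
by rewrite mulrCA ler_wpM2l ?opnorm_ge0// fM//; exists x.
Qed.

(** The weighted image is a bounded Grothendieck set, so [grothendieck_separable_image] applies; the
    converse takes [G] to be [c0 R], into which every continuous operator is separable. *)
Lemma HvO_eq_SHvKw (F : completeNormedModType R[i]) : HvO U v F = SHvKw U v F.
Proof.
apply/seteqP; split => f [fHv fK]; split => //.
  move=> G A Asep; split; first by apply: Hv_comp fHv; case: Asep.
  rewrite weighted_image_comp; have [_ [M fM]] := fHv.
  apply: (@grothendieck_separable_image _ _ _ _ _ M) => //.
  move=> _ [x Ux <-]; rewrite rnormZ norm_real_complex/=.
  by rewrite gtr0_norm ?vpos//; apply: fM; exists x.
move=> T Tcont; rewrite -weighted_image_comp.
by apply: (fK _ T _).2; split => //; exact: separable_subset_c0.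
Qed.

Lemma norming_separable_operator (F : completeNormedModType R[i]) (y : F) :
  exists A : {linear F -> c0 R},
    [/\ separable_operator A, opnorm A <= 1 & rnorm (A y) = rnorm y].
Proof.
have [phi [phi1 phiy]] := norming_functional y.
have null (a : R[i]) : (fun n => if n == 0%N then a : R[i]^o else 0) \in @null_seq R.
  apply/asboolP/cvg_rnormP => e e0; exists 1%N => // -[//|n] _ /=.
  by rewrite subrr rnorm0.
have [|A AE] := @linear_of_function R F (c0 R) (fun x => C0 (null (phi x))).
  move=> a x z; apply: val_inj; apply/funext => -[|n] /=.
    by rewrite linearP.
  by rewrite !fctE/= scaler0 addr0.
have nA x : rnorm (A x) = rnorm (phi x).
  rewrite AE c0_rnormE; apply/eqP; rewrite eq_le; apply/andP; split.
    apply: (@c0_sup_le _ (C0 (null (phi x)))) => -[|n] //=.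
    by rewrite rnorm0 rnorm_ge0.
  exact: (c0_sup_ge (C0 (null (phi x))) 0).
have A1 x : rnorm (A x) <= 1 * rnorm x.
  by rewrite nA (le_trans (opnorm_bdual_ge _ _))// ler_wpM2r// rnorm_ge0.
exists A; split.
- split; last exact: separable_subset_c0.
  by apply/continuous_linear_rnormP; exists 1.
- exact: opnorm_le.
- by rewrite nA phiy {1}/rnorm norm_real_complex/= ger0_norm ?rnorm_ge0.
Qed.

(** For empty [U] the supremum is 0 by default, which is where [0 <= M] enters. *)
Lemma weighted_norm_le (F : completeNormedModType R[i]) (f : E -> F) (M : R) :
  0 <= M -> (forall x, U x -> v x * rnorm (f x) <= M) ->
  weighted_norm U v f <= M.
Proof.
move=> M0 fM; have [[x Ux]|U0] := pselect (U !=set0).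
  apply: ge_sup; first by exists (v x * rnorm (f x)), x.
  by move=> _ [z Uz <-]; exact: fM.
rewrite /weighted_norm /weighted_norms (_ : U = set0) ?image_set0 ?sup0//.
by apply: contrapT => /eqP/set0P.
Qed.

Lemma weighted_norm_ge (F : completeNormedModType R[i]) (f : E -> F) x :
  Hv U v F f -> U x -> v x * rnorm (f x) <= weighted_norm U v f.
Proof. by move=> [_ fb] Ux; apply: ub_le_sup => //; exists x. Qed.

Lemma weighted_norm_ge0 (F : completeNormedModType R[i]) (f : E -> F) :
  Hv U v F f -> 0 <= weighted_norm U v f.
Proof.
move=> fHv; have [[x Ux]|U0] := pselect (U !=set0).
  apply: le_trans (weighted_norm_ge fHv Ux).
  by rewrite mulr_ge0 ?rnorm_ge0// ltW// vpos.
rewrite /weighted_norm /weighted_norms (_ : U = set0) ?image_set0 ?sup0//.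
by apply: contrapT => /eqP/set0P.
Qed.

(** Operators of norm at most 1 do not increase the weighted norm; conversely, for each [x] in [U]
    an operator that norms [f x] gives [v x * rnorm (f x) <= sup N]. *)
Lemma weighted_norm_eq_SHvKw_norm (F : completeNormedModType R[i])
    (f : E -> F) :
  Hv U v F f -> weighted_norm U v f = SHvKw_norm U v f.
Proof.
move=> fHv.
set N := [set r | exists (G : completeNormedModType R[i]) (A : {linear F -> G}),
    [/\ separable_operator A, opnorm A <= 1 & r = weighted_norm U v (A \o f)]].
have Nub : ubound N (weighted_norm U v f).
  move=> _ [G [A [[Acont _] A1 ->]]]; apply: weighted_norm_le.
    exact: weighted_norm_ge0.
  move=> x Ux; apply: le_trans (weighted_norm_ge fHv Ux).
  rewrite ler_wpM2l ?(ltW (vpos Ux))// (le_trans (opnorm_ge _ Acont))//.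
  by rewrite ler_piMl// rnorm_ge0.
have Nge y : exists A : {linear F -> c0 R},
    [/\ continuous A, rnorm (A y) = rnorm y &
        weighted_norm U v (A \o f) <= sup N].
  have [A [Asep A1 Ay]] := norming_separable_operator y.
  exists A; split => //; first by case: Asep.
  apply: ub_le_sup; first by exists (weighted_norm U v f).
  by exists (c0 R), A.
apply/eqP; rewrite eq_le; apply/andP; split.
  apply: weighted_norm_le => [|x Ux].
    (* [sup N] is nonnegative, as it bounds the weighted norm of one composite [A \o f]. *)
    have [A [Acont _ /(le_trans _)]] := Nge 0; apply.
    exact/weighted_norm_ge0/Hv_comp.
  have [A [Acont Ax]] := Nge (f x); apply: le_trans.
  by rewrite -Ax; apply: (@weighted_norm_ge _ (A \o f)) Ux; exact: Hv_comp.
apply: ge_sup => //.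
have [A [Asep A1 _]] := norming_separable_operator (0 : F).
by exists (weighted_norm U v (A \o f)), (c0 R), A.
Qed.

End main.

Theorem theorem3p4 (R : realType) (E : completeNormedModType R[i])
    (U : set E) (v : E -> R) (F : completeNormedModType R[i]) :
  open U -> weight U v ->
  HvO U v F = SHvKw U v F /\
  (forall f : E -> F, HvO U v F f -> weighted_norm U v f = SHvKw_norm U v f).
Proof.
move=> _ [vpos _]; split; first exact: HvO_eq_SHvKw.
by move=> f [fHv _]; exact: weighted_norm_eq_SHvKw_norm.
Qed.
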